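(* Let $\mathcal{H}$ be a separable Hilbert space and let $\mathcal{W},\mathcal{V}$ be closed subspaces of $\mathcal{H}$ with $\mathcal{H}=\mathcal{W}\oplus\mathcal{V}^{\perp}$. Let $\mathcal{F}=\{f_k\}_{k=1}^{\infty}$ be a frame for $\mathcal{W}$, let $\{\delta_k\}_{k=1}^{\infty}$ be the canonical basis of $\ell^2(\mathbb{N})$, and let $0\le\epsilon<1$. Then the $\epsilon$-approximate oblique dual frames of $\mathcal{F}$ in $\mathcal{V}$ are exactly the sequences $\{g_k\}_{k=1}^{\infty}=\{A\delta_k\}_{k=1}^{\infty}$, where $A:\ell^2(\mathbb{N})\to\mathcal{V}$ is an $\epsilon$-approximate oblique left inverse of $T_{\mathcal{F}}^{*}$ in $\mathcal{V}$ along $\mathcal{W}^{\perp}$.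
   Context: The direct sum $\mathcal{H}=\mathcal{W}\oplus\mathcal{V}^{\perp}$ (equivalently $\mathcal{H}=\mathcal{V}\oplus\mathcal{W}^{\perp}$) is not assumed orthogonal. $\pi_{\mathcal{W}\mathcal{V}^{\perp}}$ denotes the oblique projection onto $\mathcal{W}$ along $\mathcal{V}^{\perp}$ (identity on $\mathcal{W}$, zero on $\mathcal{V}^{\perp}$); similarly $\pi_{\mathcal{V}\mathcal{W}^{\perp}}$ is the projection onto $\mathcal{V}$ along $\mathcal{W}^{\perp}$. A sequence $\{f_k\}_{k=1}^{\infty}\subset\mathcal{W}$ is a frame for $\mathcal{W}$ if there are $0<\alpha\le\beta<\infty$ with $\alpha\|f\|^2\le\sum_{k}|\langle f,f_k\rangle|^2\le\beta\|f\|^2$ for all $f\in\mathcal{W}$. For $\mathcal{F}=\{f_k\}$, the synthesis operator is $T_{\mathcal{F}}:\ell^2(\mathbb{N})\to\mathcal{H}$, $T_{\mathcal{F}}\{c_k\}=\sum_k c_kf_k$, with adjoint $T_{\mathcal{F}}^{*}f=\{\langle f,f_k\rangle\}_k$. Frames $\mathcal{F}$ for $\mathcal{W}$ and $\mathcal{G}$ for $\mathcal{V}$ are $\epsilon$-approximate oblique dual frames (and $\mathcal{G}$ is an $\epsilon$-approximate oblique dual frame of $\mathcal{F}$ in $\mathcal{V}$) if $\|\pi_{\mathcal{W}\mathcal{V}^{\perp}}-T_{\mathcal{F}}T_{\mathcal{G}}^{*}\|\le\epsilon$ or, equivalently, $\|\pi_{\mathcal{V}\mathcal{W}^{\perp}}-T_{\mathcal{G}}T_{\mathcal{F}}^{*}\|\le\epsilon$.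 A bounded linear operator $A:\ell^2(\mathbb{N})\to\mathcal{V}$ is an $\epsilon$-approximate oblique left inverse of $T_{\mathcal{F}}^{*}$ in $\mathcal{V}$ along $\mathcal{W}^{\perp}$ if $\|\pi_{\mathcal{V}\mathcal{W}^{\perp}}-AT_{\mathcal{F}}^{*}\|\le\epsilon$. *)

(* Defs.v *)
From HB Require Import structures.
From mathcomp Require Import all_boot all_order all_algebra.
From mathcomp Require Import complex ring.
From mathcomp Require Import all_classical all_reals all_analysis.

Set Implicit Arguments.
Unset Strict Implicit.
Unset Printing Implicit Defensive.

Import Order.TTheory GRing.Theory Num.Theory.
Import numFieldNormedType.Exports.

Local Open Scope classical_set_scope.
Local Open Scope ring_scope.

(* Hilbert spaces are taken over either of the fields R and R[i]. *)
Inductive scalar_kind := RealScalars | ComplexScalars.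

Definition scalars (R : realType) (k : scalar_kind) : numFieldType :=
  match k with RealScalars => R | ComplexScalars => R[i] end.

Definition conjugation (R : realType) (k : scalar_kind) :
    involutive_rmorphism (scalars R k) :=
  match k with
  | RealScalars => (@idfun R : involutive_rmorphism R)
  | ComplexScalars => (@Num.conj R[i] : involutive_rmorphism R[i])
  end.

Definition realpart (R : realType) (k : scalar_kind) : scalars R k -> R :=
  match k with
  | RealScalars => fun x => x
  | ComplexScalars => fun z => complex.Re z
  end.

(* Library norms take their values in the scalar field; [rnorm] is the same
   norm with values in R. *)
Definition rnorm (R : realType) (k : scalar_kind)
  (V : normedZmodType (scalars R k)) (x : V) : R := realpart `|x|.

Definition opnorm (R : realType) (X Y : Type) (nX : X -> R) (nY : Y -> R)
    (T : X -> Y) : \bar R :=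
  ereal_sup [set (nY (T x))%:E | x in [set x | nX x <= 1]].

Section SquareSummable.
Variables (R : realType) (k : scalar_kind).
Local Notation K := (scalars R k).

Definition sqsum (c : nat -> K) : \bar R :=
  (\sum_(0 <= n <oo) ((rnorm (c n)) ^+ 2)%:E)%E.

(* K^o (convertible to K) carries the structure of K-module of K. *)
Definition sqsummable : {pred nat -> K^o} :=
  fun c => `[< (sqsum c < +oo)%E >].

Lemma rnorm_ge0 (V : normedZmodType K) (x : V) : 0 <= rnorm x.
Proof.
have := normr_ge0 x; rewrite /rnorm; move: `|x|; rewrite /realpart.
by case: (k) => //= -[a b]; rewrite lecE => /andP[].
Qed.

Lemma rnormD (V : normedZmodType K) (x y : V) :
  rnorm (x + y) <= rnorm x + rnorm y.
Proof.
have := ler_normD x y; rewrite /rnorm; move: `|x + y| `|x| `|y|.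
rewrite /realpart; case: (k) => //= -[a b] [c d] [e f].
by rewrite lecE => /andP[].
Qed.

Lemma rnormM (x y : K) : rnorm (x * y) = rnorm x * rnorm y.
Proof.
rewrite /rnorm normrM; have := normr_real x; have := normr_real y.
move: `|x| `|y|; rewrite /realpart; case: (k) => //= -[a b] [c d].
rewrite !complex_real /=.
by move=> /eqP -> /eqP ->; rewrite mulr0 subr0.
Qed.

Lemma rnorm0 : rnorm (0 : K) = 0.
Proof. by rewrite /rnorm normr0 /realpart; case: (k). Qed.

Lemma sqsummable_submod : submod_closed sqsummable.
Proof.
split=> [|a u v].
  apply/asboolP; rewrite /sqsum eseries0 ?ltry// => n _ _.
  by rewrite (_ : (0 : nat -> K^o) n = 0)// rnorm0 expr0n.
move=> /asboolP hu /asboolP hv; apply/asboolP.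
pose s (c : nat -> K) n : \bar R := ((rnorm (c n)) ^+ 2)%:E.
have s0 c n : (0 <= s c n)%E by rewrite lee_fin sqr_ge0.
apply: (@le_lt_trans _ _
  ((2 * rnorm a ^+ 2)%:E * sqsum u + 2%:E * sqsum v)%E); last first.
  have fin c : (sqsum c < +oo)%E -> sqsum c \is a fin_num.
    by move=> h; rewrite ge0_fin_numE //; apply: nneseries_ge0 => n _ _; exact: s0.
  by rewrite -(fineK (fin _ hu)) -(fineK (fin _ hv)) -!EFinM -EFinD ltry.
rewrite /sqsum -!nneseriesZl//; try by move=> n _; exact: s0.
have c0 : 0 <= 2 * rnorm a ^+ 2 by rewrite mulr_ge0 ?sqr_ge0.
rewrite -nneseriesD//; last 2 first.
- by move=> n _ _; rewrite mule_ge0// lee_fin ?sqr_ge0.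
- by move=> n _ _; rewrite mule_ge0// lee_fin ?sqr_ge0.
apply: lee_nneseries => n; first by rewrite lee_fin sqr_ge0.
move=> _; rewrite -!EFinM -EFinD lee_fin.
rewrite -mulrA -exprMn -rnormM -mulrDr.
have -> : (a *: u + v) n = a * u n + v n by [].
apply: (@le_trans _ _ ((rnorm (a * u n) + rnorm (v n)) ^+ 2)).
  rewrite ler_pXn2r ?nnegrE ?addr_ge0 ?rnorm_ge0//; exact: rnormD.
rewrite -subr_ge0.
set x := rnorm (_ * _); set y := rnorm _.
suff -> : 2 * (x ^+ 2 + y ^+ 2) - (x + y) ^+ 2 = (x - y) ^+ 2.
  exact: sqr_ge0.
ring.
Qed.

HB.instance Definition _ :=
  GRing.isSubmodClosed.Build K (nat -> K^o) sqsummable sqsummable_submod.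

Record ell2 := Ell2 {
  ell2_seq :> nat -> K^o;
  ell2P : ell2_seq \in sqsummable }.

HB.instance Definition _ := [isSub for ell2_seq].
HB.instance Definition _ := [Choice of ell2 by <:].
HB.instance Definition _ := [SubChoice_isSubLmodule of ell2 by <:].

Definition ell2_norm (c : ell2) : R := Num.sqrt (fine (sqsum c)).

Lemma delta_sqsummable (n : nat) :
  (fun m => (m == n)%:R : K^o) \in sqsummable.
Proof.
apply/asboolP; rewrite /sqsum (@nneseries_split _ _ _ n.+1)//; last first.
  by move=> m _; rewrite lee_fin sqr_ge0.
rewrite [X in (_ + X)%E]eseries0 ?adde0 ?sumEFin ?ltry// => m.
by rewrite add0n => + _ => /gtn_eqF ->; rewrite rnorm0 expr0n.
Qed.

Definition delta (n : nat) : ell2 := Ell2 (delta_sqsummable n).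

End SquareSummable.

Definition separable (T : topologicalType) : Prop :=
  exists2 D : set T, countable D & dense D.

Section ObliqueDuals.
Variables (R : realType) (k : scalar_kind).
Local Notation K := (scalars R k).
Variable H : completeNormedModType K.

Definition induces_norm (dot : H -> H -> K) : Prop :=
  forall x : H, `|x| ^+ 2 = dot x x.

Definition closed_subspace (U : set H) : Prop :=
  closed U /\ submod_closed [pred x | x \in U].

Definition direct_sum (U U' : set H) : Prop :=
  (forall x, exists u u', [/\ U u, U' u' & x = u + u'])
  /\ U `&` U' = [set 0].

(* The projection onto U along U' when H is the direct sum of U and U'. *)
Definition oblique_proj (U U' : set H) (x : H) : H :=
  xget 0 [set u | U u /\ U' (x - u)].

(* Meaningful when the series converges. *)
Definition synthesis (F : nat -> H) (c : ell2 R k) : H :=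
  limn (series (fun n => c n *: F n)).

Variable dot : H -> H -> K.

Definition orthogonal_complement (U : set H) : set H :=
  [set x | forall u, U u -> dot x u = 0].

Definition is_frame (U : set H) (F : nat -> H) : Prop :=
  (forall n, U (F n)) /\
  exists alpha beta : R, [/\ 0 < alpha, alpha <= beta &
    forall f, U f ->
      ((alpha * rnorm f ^+ 2)%:E <= sqsum (fun n => dot f (F n)))%E /\
      (sqsum (fun n => dot f (F n)) <= (beta * rnorm f ^+ 2)%:E)%E].

(* The sequence (<f, F n>)_n, which is square summable for all f as soon as F
   is a frame for a closed subspace; 0 if it is not square summable. *)
Definition analysis (F : nat -> H) (f : H) : ell2 R k :=
  insubd (0 : ell2 R k) (fun n => dot f (F n) : K^o).

Definition approx_oblique_dual (eps : R) (W V : set H) (F G : nat -> H) :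
    Prop :=
  [/\ is_frame W F, is_frame V G &
    (opnorm (@rnorm R k H) (@rnorm R k H)
       (fun f => oblique_proj W (orthogonal_complement V) f
                 - synthesis F (analysis G f))%R <= eps%:E)%E].

Definition approx_oblique_left_inverse (eps : R) (W V : set H) (F : nat -> H)
    (A : {linear ell2 R k -> H}) : Prop :=
  [/\ forall c, V (A c),
      (opnorm (@ell2_norm R k) (@rnorm R k H) A < +oo)%E &
      (opnorm (@rnorm R k H) (@rnorm R k H)
         (fun f => oblique_proj V (orthogonal_complement W) f
                   - A (analysis F f))%R <= eps%:E)%E].

End ObliqueDuals.

(* Main.v *)
Require Import Defs.
From HB Require Import structures.
From mathcomp Require Import all_boot all_order all_algebra.
From mathcomp Require Import complex ring lra.
From mathcomp Require Import all_classical all_reals all_analysis.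

(* The adjoint of T_F T_G^* is T_G T_F^*, and the adjoint of the projection onto
   W along V^⊥ is the projection onto V along W^⊥, so the two error operators
   have the same norm; the correspondence is G = (A delta_n)_n, A = T_G. The
   second projection has to be shown to exist. No closed graph argument is
   needed: in either direction the hypothesis bounds one of the projections
   (an error of norm at most eps plus a composite of bounded operators), hence
   |v| <= M |v + z| for v in V and z in W^⊥, so V + W^⊥ is complete; its
   orthogonal complement is contained in the intersection of W and V^⊥ and
   vanishes. The lower frame bound of (A delta_n)_n on V comes from
   |f|^2 = <f, f - T_G T_F^* f> + <T_F T_G^* f, f> for f in V. *)

Set Implicit Arguments.
Unset Strict Implicit.
Unset Printing Implicit Defensive.

Import Order.TTheory GRing.Theory Num.Theory.
Import numFieldNormedType.Exports.

Local Open Scope classical_set_scope.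
Local Open Scope ring_scope.

(** * Real and complex scalars treated together, with norms brought down to R *)

Section Scalars.
Variables (R : realType) (k : scalar_kind).
Local Notation K := (scalars R k).

(** The embedding of R into K. Scalar-valued norms are values of it ([normE]), so estimates between
    them reduce to inequalities over R. *)
Definition real_scalar : R -> K :=
  match k with RealScalars => fun x => x | ComplexScalars => fun x => x%:C%C end.

Lemma realpart_real r : realpart (real_scalar r) = r.
Proof. by rewrite /realpart /real_scalar; case: (k). Qed.

Lemma realpartD (a b : K) : realpart (a + b) = realpart a + realpart b.
Proof. by move: a b; rewrite /realpart; case: (k) => //= -[a b] [c d]. Qed.

Lemma realpartB (a b : K) : realpart (a - b) = realpart a - realpart b.
Proof. by move: a b; rewrite /realpart; case: (k) => //= -[a b] [c d]. Qed.

Lemma realpart_sum (u : nat -> K) m n :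
  realpart (\sum_(m <= i < n) u i) = \sum_(m <= i < n) realpart (u i).
Proof.
apply: (big_morph _ realpartD); rewrite /realpart; by case: (k).
Qed.

Lemma real_scalar_gt0 r : (0 < real_scalar r) = (0 < r).
Proof. by rewrite /real_scalar; case: (k) => //=; rewrite ltcR. Qed.

Lemma real_scalarD r s : real_scalar (r + s) = real_scalar r + real_scalar s.
Proof. by rewrite /real_scalar; case: (k) => //=; rewrite rmorphD. Qed.

Lemma real_scalarB r s : real_scalar (r - s) = real_scalar r - real_scalar s.
Proof. by rewrite /real_scalar; case: (k) => //=; rewrite rmorphB. Qed.

Lemma real_scalarM r s : real_scalar (r * s) = real_scalar r * real_scalar s.
Proof. by rewrite /real_scalar; case: (k) => //=; rewrite rmorphM. Qed.

Lemma real_scalar1 : real_scalar 1 = 1.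
Proof. by rewrite /real_scalar; case: (k). Qed.

Lemma normE (V : normedZmodType K) (x : V) : `|x| = real_scalar (rnorm x).
Proof.
have := normr_real x; rewrite /rnorm; move: `|x|.
rewrite /realpart /real_scalar; case: (k) => //= -[a b].
by rewrite complex_real => /eqP /= ->.
Qed.

Lemma real_scalar_gt0P (e : K) : 0 < e ->
  exists2 r : R, 0 < r & e = real_scalar r.
Proof.
move=> e0; exists (rnorm e); last by rewrite -normE gtr0_norm.
by rewrite -real_scalar_gt0 -normE normr_gt0 gt_eqF.
Qed.

Lemma real_scalar_lt r s : (real_scalar r < real_scalar s) = (r < s).
Proof. by rewrite /real_scalar; case: (k) => //=; rewrite ltcR. Qed.

Lemma real_scalar_inj : injective real_scalar.
Proof. by move=> r s /(congr1 (@realpart R k)); rewrite !realpart_real. Qed.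

Lemma rnorm_eq0 (V : normedZmodType K) (x : V) : (rnorm x == 0) = (x == 0).
Proof.
rewrite -[RHS]normr_eq0 normE; apply/eqP/eqP => [->|/(congr1 (@realpart R k))].
  by rewrite /real_scalar; case: (k).
by rewrite realpart_real => ->; rewrite /realpart; case: (k).
Qed.

Lemma rnorm0V (V : normedZmodType K) : rnorm (0 : V) = 0.
Proof. by apply/eqP; rewrite rnorm_eq0. Qed.

Lemma rnormN (V : normedZmodType K) (x : V) : rnorm (- x) = rnorm x.
Proof. by rewrite /rnorm normrN. Qed.

Lemma rnormC (V : normedZmodType K) (x y : V) : rnorm (x - y) = rnorm (y - x).
Proof. by rewrite -rnormN opprB. Qed.

Lemma rnorm_real r : 0 <= r -> rnorm (real_scalar r) = r.
Proof.
move=> r0; rewrite /rnorm ger0_norm ?realpart_real//.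
by rewrite /real_scalar; case: (k) => //=; rewrite lecR.
Qed.

Lemma rnormZ (V : normedModType K) (a : K) (x : V) :
  rnorm (a *: x) = rnorm a * rnorm x.
Proof.
by apply: real_scalar_inj; rewrite real_scalarM -!normE normrZ.
Qed.

Lemma realpart_le_rnorm (a : K) : realpart a <= rnorm a.
Proof.
rewrite /rnorm /realpart; move: a; case: (k) => /= [|[a b]].
  exact: ler_norm.
rewrite (le_trans (ler_norm a))// -sqrtr_sqr ler_sqrt ?addr_ge0 ?sqr_ge0//.
by rewrite lerDl sqr_ge0.
Qed.

Lemma rnorm_conj (a : K) : rnorm (conjugation R k a) = rnorm a.
Proof.
rewrite /rnorm /conjugation; move: a; case: (k) => // a.
by rewrite [X in _ X = _](norm_conjC (a : R[i])).
Qed.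

Lemma mul_conj (a : K) : a * conjugation R k a = real_scalar (rnorm a ^+ 2).
Proof.
rewrite expr2 real_scalarM -!normE /conjugation -expr2.
move: a; case: (k) => /= a; last by rewrite normCK.
by rewrite real_normK ?num_real.
Qed.

Lemma conj_real r : conjugation R k (real_scalar r) = real_scalar r.
Proof.
rewrite /conjugation /real_scalar; case: (k) => //=.
by apply/CrealP; rewrite complex_real.
Qed.

End Scalars.

(** * Limits and Cauchy sequences in terms of the real-valued norm *)

Section Convergence.
Variables (R : realType) (k : scalar_kind).
Local Notation K := (scalars R k).
Variable H : completeNormedModType K.
Implicit Types (u : nat -> H) (l : H).

Lemma cvg_rnormP u l :
  u @ \oo --> l <-> rnorm (u n - l) @[n --> \oo] --> (0 : R).
Proof.
split=> [/cvgrPdist_lt ul|/cvgrPdist_lt ul]; apply/cvgrPdist_lt => e e0.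
  have /ul : 0 < real_scalar k e by rewrite real_scalar_gt0.
  apply: filterS => n; rewrite normE real_scalar_lt rnormC => h.
  by rewrite sub0r normrN ger0_norm// rnorm_ge0.
have [r r0 ->] := real_scalar_gt0P e0.
apply: filterS (ul r r0) => n.
by rewrite sub0r normrN ger0_norm ?rnorm_ge0// normE real_scalar_lt rnormC.
Qed.

Lemma rnorm_cauchy_cvg u :
  (forall e : R, 0 < e -> exists N, forall m n, (N <= m)%N -> (N <= n)%N ->
     rnorm (u m - u n) < e) ->
  exists l, u @ \oo --> l.
Proof.
move=> uc; apply/cvg_ex/cauchy_cvgP/cauchy_ballP => e e0.
have [r r0 ->] := real_scalar_gt0P e0.
have [N uN] := uc r r0.
exists (u @` [set n | (N <= n)%N], u @` [set n | (N <= n)%N]).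
  by split; exists N => // n Nn; exists n.
move=> [_ _] /= [[m mN <-] [n nN <-]].
rewrite -ball_normE /= normE real_scalar_lt.
exact: uN.
Qed.

(** Common form of the limit passages below: [c] measures a defect that must vanish, [r] the error
    of an approximation. *)
Lemma le0_cvg0 (c M : R) (r : nat -> R) :
  r @ \oo --> (0 : R) -> (forall n, c <= M * r n) -> c <= 0.
Proof.
move=> r0 cr; have h : M * r n @[n --> \oo] --> M * 0.
  by apply: cvgM => //; exact: cvg_cst.
rewrite -(mulr0 M) -(cvg_lim (@Rhausdorff R) h).
apply: limr_ge; first by apply/cvg_ex; exists (M * 0).
by apply: nearW.
Qed.

End Convergence.

(** * Cauchy-Schwarz inequality, parallelogram law, continuity of the inner product *)

Section InnerProduct.
Variables (R : realType) (k : scalar_kind).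
Local Notation K := (scalars R k).
Variable H : completeNormedModType K.
Variable dot : {dot H for conjugation R k}.
Hypothesis dotn : induces_norm dot.
Local Notation conj := (conjugation R k).
Local Notation rs := (real_scalar k).
Implicit Types (x y u v w : H).

Lemma dotC x y : dot x y = conj (dot y x).
Proof. by rewrite (hermC dot) expr0 mul1r. Qed.

Lemma dotZl a x y : dot (a *: x) y = a * dot x y.
Proof. exact: linearZl_LR. Qed.

Lemma dotZr a x y : dot x (a *: y) = conj a * dot x y.
Proof. exact: linearZr_LR. Qed.

Lemma dotBl x y z : dot (x - y) z = dot x z - dot y z.
Proof. exact: linearBl. Qed.

Lemma dotBr x y z : dot x (y - z) = dot x y - dot x z.
Proof. exact: linearBr. Qed.

Lemma dotDl x y z : dot (x + y) z = dot x z + dot y z.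
Proof. exact: linearDl. Qed.

Lemma dotDr x y z : dot x (y + z) = dot x y + dot x z.
Proof. exact: linearDr. Qed.

Lemma dot_eq0C x y : dot x y = 0 -> dot y x = 0.
Proof. by move=> h; rewrite dotC h rmorph0. Qed.

Lemma dotxx x : dot x x = rs (rnorm x ^+ 2).
Proof. by rewrite -dotn normE !expr2 real_scalarM. Qed.

Lemma realpart_dotxx x : realpart (dot x x) = rnorm x ^+ 2.
Proof. by rewrite dotxx realpart_real. Qed.

(** All cross terms are real multiples of [dot x u * conj (dot x u)]; the rewritings in the proof
    bring them to that shape for [mul_conj]. The minimizing [t] is the inverse of the squared norm
    of [u]. *)
Lemma rnormB_dot (t : R) x u :
  rnorm (x - (rs t * dot x u) *: u) ^+ 2 =
  rnorm x ^+ 2 - 2 * t * rnorm (dot x u) ^+ 2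
    + t ^+ 2 * rnorm (dot x u) ^+ 2 * rnorm u ^+ 2.
Proof.
apply: (@real_scalar_inj _ k); rewrite -dotxx.
rewrite dotBl !dotBr !dotZl !dotZr !rmorphM/= -dotC conj_real !dotxx.
rewrite !mulrA.
have -> : rs t * dot u x * dot x u = rs t * (dot x u * conj (dot x u)).
  by rewrite -dotC; ring.
have -> : rs t * dot x u * rs t * dot u x * rs (rnorm u ^+ 2) =
  rs t * rs t * (dot x u * conj (dot x u)) * rs (rnorm u ^+ 2).
  by rewrite -dotC; ring.
have -> : rs t * dot x u * dot u x = rs t * (dot x u * conj (dot x u)).
  by rewrite -dotC; ring.
rewrite !mul_conj -!real_scalarM -!real_scalarB; congr rs; ring.
Qed.

(* The distance from [x] to the line spanned by [u] is attained at the
   orthogonal projection of [x]. *)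
Lemma dot_le_dist (r : R) x u :
  (forall a, r <= rnorm (x - a *: u) ^+ 2) ->
  rnorm (dot x u) ^+ 2 <= (rnorm x ^+ 2 - r) * rnorm u ^+ 2.
Proof.
move=> /(_ (rs (rnorm u ^+ 2)^-1 * dot x u)); rewrite rnormB_dot.
have [->|u0] := eqVneq u 0.
  by rewrite linear0r !rnorm0V expr0n/= !mulr0.
have n0 : 0 < rnorm u ^+ 2 by rewrite exprn_gt0// lt_def rnorm_eq0 u0 rnorm_ge0.
rewrite -ler_pdivrMr//.
set N := rnorm u ^+ 2 in n0 *; set d := rnorm (dot x u) ^+ 2; set X := rnorm x ^+ 2.
have -> : N^-1 ^+ 2 * d * N = d / N by field; rewrite gt_eqF.
rewrite -mulrA (mulrC N^-1); lra.
Qed.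

(** The case [r = 0] of [dot_le_dist], squared distances being nonnegative. *)
Lemma CauchySchwarz_rnorm x u : rnorm (dot x u) <= rnorm x * rnorm u.
Proof.
rewrite -ler_sqr ?nnegrE ?mulr_ge0 ?rnorm_ge0// exprMn.
have := @dot_le_dist 0 x u; rewrite subr0; apply => a.
by rewrite sqr_ge0.
Qed.

Lemma parallelogram x y :
  rnorm (x + y) ^+ 2 + rnorm (x - y) ^+ 2 = 2 * (rnorm x ^+ 2 + rnorm y ^+ 2).
Proof.
rewrite -!realpart_dotxx dotBl !dotBr dotDl !dotDr.
rewrite !(realpartB, realpartD); lra.
Qed.

Lemma dot_cvgl (u_ : nat -> H) l y : u_ @ \oo --> l ->
  rnorm (dot (u_ n) y - dot l y) @[n --> \oo] --> (0 : R).
Proof.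
move=> /cvg_rnormP ul.
have h : rnorm (u_ n - l) * rnorm y @[n --> \oo] --> (0 * rnorm y : R).
  by apply: cvgM => //; exact: cvg_cst.
rewrite mul0r in h.
apply: (squeeze_cvgr _ (cvg_cst (0 : R)) h).
by apply: nearW => n; rewrite rnorm_ge0 -dotBl CauchySchwarz_rnorm.
Qed.

Lemma dot_cvgl_eq0 (u_ : nat -> H) l y : u_ @ \oo --> l ->
  (forall n, dot (u_ n) y = 0) -> dot l y = 0.
Proof.
move=> /(@dot_cvgl _ _ y) ul u0; apply/eqP; rewrite -rnorm_eq0 eq_le rnorm_ge0 andbT.
by apply: (le0_cvg0 (M := 1) ul) => n; rewrite mul1r u0 sub0r rnormN.
Qed.

End InnerProduct.

(** * Orthogonal projection onto complete subspaces; decomposition along V and [W^⊥] *)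

Section Projection.
Variables (R : realType) (k : scalar_kind).
Local Notation K := (scalars R k).
Variable H : completeNormedModType K.
Variable dot : {dot H for conjugation R k}.
Hypothesis dotn : induces_norm dot.
Local Notation rs := (real_scalar k).
Local Notation "U ^⊥" := (orthogonal_complement dot U)
  (at level 1, format "U ^⊥").
Implicit Types (U V W : set H).

Definition subspace U := U 0 /\ forall a x y, U x -> U y -> U (a *: x + y).

Lemma subspaceD U x y : subspace U -> U x -> U y -> U (x + y).
Proof. by move=> [_ h] ux uy; have := h 1 x y ux uy; rewrite scale1r. Qed.

Lemma subspaceZ U a x : subspace U -> U x -> U (a *: x).
Proof. by move=> [u0 h] ux; have := h a x 0 ux u0; rewrite addr0. Qed.

Lemma subspaceB U x y : subspace U -> U x -> U y -> U (x - y).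
Proof.
move=> sU ux uy; apply: subspaceD => //.
by rewrite -scaleN1r; exact: subspaceZ.
Qed.

Lemma subspace_sum U (F : nat -> H) m n : subspace U ->
  (forall i, U (F i)) -> U (\sum_(m <= i < n) F i).
Proof.
move=> sU UF; elim/big_ind: _ => // [|x y]; first by case: sU.
exact: subspaceD.
Qed.

Lemma closed_subspace_subspace U : closed_subspace U -> subspace U.
Proof.
move=> [_ [U0 UP]]; split=> [|a x y ux uy]; first by move: U0; rewrite !inE.
by have := UP a x y; rewrite !inE; exact.
Qed.

(** This form suits [V + W^⊥], whose completeness is proved by splitting a Cauchy sequence into its
    components. *)
Definition sequentially_complete U := forall u : nat -> H, (forall n, U (u n)) ->
  (forall e : R, 0 < e -> exists N, forall m n, (N <= m)%N -> (N <= n)%N ->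
     rnorm (u m - u n) < e) ->
  exists2 l, U l & u @ \oo --> l.

Lemma closed_sequentially_complete U : closed U -> sequentially_complete U.
Proof.
move=> cU u Uu /rnorm_cauchy_cvg[l ul]; exists l => //.
by apply: (closed_cvg _ cU _ _ ul); exact: nearW.
Qed.

Lemma orthogonal_complement_subspace U : subspace U^⊥.
Proof.
split=> [u _|a x y hx hy u Uu]; first exact: linear0l.
by rewrite dotDl dotZl hx// hy// mulr0 addr0.
Qed.

(** A minimizing sequence for the distance from [x] to [U] is Cauchy by the parallelogram law.
    Orthogonality of the residual follows from [dot_le_dist] along the sequence, since the excess of
    the squared distance over its infimum tends to 0. *)
Lemma orthogonal_projection U x : subspace U -> sequentially_complete U ->
  exists2 v, U v & U^⊥ (x - v).
Proof.
move=> sU cU; pose E := [set rnorm (x - u) ^+ 2 | u in U].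
have lbE : has_lbound E by exists 0 => _ [u _ <-]; exact: sqr_ge0.
have E0 : has_inf E.
  by split=> //; exists (rnorm (x - 0) ^+ 2); exists 0 => //; case: sU.
set d := inf E.
have dle u : U u -> d <= rnorm (x - u) ^+ 2.
  by move=> Uu; apply: ge_inf => //; exists u.
have /choice[u /all_and2[Uu ud]] : forall n : nat, exists u,
    U u /\ rnorm (x - u) ^+ 2 < d + n.+1%:R^-1.
  move=> n; have n0 : (0 : R) < n.+1%:R^-1 by rewrite invr_gt0.
  by have [_ [u Uu <-] h] := inf_adherent n0 E0; exists u.
(* The midpoint of [u m] and [u n] lies in [U], so its squared distance to [x] is at least [d]; the
   terms [4 * d] cancel in the parallelogram law. *)
have um m n : rnorm (u m - u n) ^+ 2 <= 2 * (m.+1%:R^-1 + n.+1%:R^-1).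
  have := parallelogram dotn (x - u n) (x - u m).
  have -> : x - u n - (x - u m) = u m - u n.
    by rewrite opprB addrC addrA subrK.
  have -> : x - u n + (x - u m) = rs 2 *: (x - rs 2^-1 *: (u n + u m)).
    rewrite scalerBr scalerA -real_scalarM divff// real_scalar1 scale1r.
    rewrite (real_scalarD k 1 1) real_scalar1 scalerDl scale1r.
    by rewrite opprD addrACA.
  rewrite rnormZ rnorm_real// exprMn.
  have := dle _ (subspaceZ (rs 2^-1) sU (subspaceD sU (Uu n) (Uu m))).
  have := ud n; have := ud m; set a := rnorm _ ^+ 2; set b := rnorm _ ^+ 2.
  set c := rnorm _ ^+ 2; set f := rnorm _ ^+ 2.
  set p := _^-1; set q := _^-1; lra.
have [l Ul ul] : exists2 l, U l & u @ \oo --> l.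
  apply: cU => // e e0.
  have e2 : 0 < e ^+ 2 / 4 by rewrite divr_gt0// exprn_gt0.
  have [N _ hN] := near_infty_natSinv_lt (PosNum e2).
  exists N => m n Nm Nn.
  have mN : m.+1%:R^-1 < e ^+ 2 / 4 := hN m Nm.
  have nN : n.+1%:R^-1 < e ^+ 2 / 4 := hN n Nn.
  rewrite -(ltr_pXn2r (n := 2))// ?nnegrE ?rnorm_ge0 ?(ltW e0)//.
  apply: le_lt_trans (um m n) _; move: mN nN.
  by move: (m.+1%:R^-1) (n.+1%:R^-1) (e ^+ 2) => p q s; lra.
exists l => // v Uv; apply/eqP; rewrite -rnorm_eq0 -[_ == 0]sqrf_eq0.
rewrite eq_le sqr_ge0 andbT.
have h n : rnorm (dot (x - u n) v) ^+ 2 <= harmonic n * rnorm v ^+ 2.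
  apply: (@le_trans _ _ ((rnorm (x - u n) ^+ 2 - d) * rnorm v ^+ 2)).
    apply: dot_le_dist => // a; rewrite -addrA -opprD; apply: dle.
    by rewrite addrC; apply: subspaceD => //; exact: subspaceZ.
  by rewrite ler_wpM2r ?sqr_ge0//= lerBlDl ltW.
(* With [x - l] split at [u n], the squared sum is at most twice the sum of the squares; this null
   sequence, times twice the squared norm of [v], bounds the result. *)
have rl : rnorm (u n - l) * rnorm (u n - l) + harmonic n @[n --> \oo] --> (0 : R).
  rewrite -[0]addr0 -[X in X + _](mulr0 0); apply: cvgD; last exact: cvg_harmonic.
  by apply: cvgM; apply/cvg_rnormP.
apply: (le0_cvg0 (M := 2 * rnorm v ^+ 2) rl) => n.
have -> : x - l = (x - u n) + (u n - l) by rewrite addrA subrK.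
rewrite dotDl.
have := h n; have := CauchySchwarz_rnorm dotn (u n - l) v.
have := rnormD (dot (x - u n) v) (dot (u n - l) v).
move: (rnorm_ge0 (dot (x - u n) v)) (rnorm_ge0 (dot (u n - l) v)).
move: (rnorm_ge0 (dot (x - u n) v + dot (u n - l) v)).
set s := rnorm (_ + _); set a := rnorm (dot _ v); set b := rnorm (dot _ v).
move: (rnorm (u n - l)) (rnorm v) (harmonic n) => p q t.
move=> s0 a0 b0 sab bpq at2.
have : s ^+ 2 <= (a + b) ^+ 2 by rewrite ler_pXn2r ?nnegrE ?addr_ge0.
have : b ^+ 2 <= (p * q) ^+ 2.
  by rewrite ler_pXn2r ?nnegrE//; exact: le_trans bpq.
have := sqr_ge0 (a - b); rewrite exprMn !expr2; rewrite expr2 in at2; lra.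
Qed.

(** The residual of the projection of [x] lies in [U^⊥], so it is orthogonal to [x] and to the
    projection, hence to itself. *)
Lemma orthogonal_complementK U x : subspace U -> sequentially_complete U ->
  (U^⊥)^⊥ x -> U x.
Proof.
move=> sU cU hx; have [u Uu xu] := orthogonal_projection x sU cU.
suff /eqP : rnorm (x - u) = 0 by rewrite rnorm_eq0 subr_eq0 => /eqP ->.
apply/eqP; rewrite -[_ == 0]sqrf_eq0 -(realpart_dotxx dotn) dotBl hx//.
by rewrite (dot_eq0C (xu _ Uu)) subr0 /realpart; case: (k).
Qed.

(** The point [x] is projected onto [V + W^⊥]. The residual is orthogonal to V, and also to [W^⊥],
    hence in W by [orthogonal_complementK]; so it is 0. *)
Lemma dual_decomposition W V (M : R) :
  subspace W -> sequentially_complete W ->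
  subspace V -> sequentially_complete V ->
  W `&` V^⊥ = [set 0] ->
  (forall v z, V v -> W^⊥ z -> rnorm v <= M * rnorm (v + z)) ->
  forall x, exists2 v, V v & W^⊥ (x - v).
Proof.
move=> sW cW sV cV WV0 vM x.
have sP := orthogonal_complement_subspace W.
pose U := [set y | exists2 v, V v & W^⊥ (y - v)].
have VU v : V v -> U v by exists v => //; rewrite subrr; case: sP.
have PU z : W^⊥ z -> U z by exists 0; [case: sV|rewrite subr0].
have sU : subspace U.
  split; first by apply: VU; case: sV.
  move=> a y z [v Vv yv] [w Vw zw]; exists (a *: v + w).
    by case: sV => _; exact.
  rewrite opprD addrACA -scalerBr; by case: sP => _; exact.
have cU : sequentially_complete U.
  move=> u Uu uc.
  have /choice[v /all_and2[Vv uv]] : forall n, exists v, V v /\ W^⊥ (u n - v).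
    by move=> n; have [v] := Uu n; exists v.
  have [l _ ul] := closed_sequentially_complete closedT (fun=> I) uc.
  have [p Vp vp] : exists2 p, V p & v @ \oo --> p.
    (* The sign of [M] is unknown; [|M| + 1] is positive and bounds it from above. *)
    apply: cV => // e e0; have [|N hN] := uc (e / (`|M| + 1)).
      by rewrite divr_gt0// ltr_wpDl.
    exists N => m n mN nN; have := hN m n mN nN.
    rewrite ltr_pdivlMr ?ltr_wpDl//; apply: le_lt_trans.
    apply: le_trans (vM (v m - v n) ((u m - v m) - (u n - v n)) _ _) _.
    - exact: (subspaceB sV (Vv m) (Vv n)).
    - exact: (subspaceB sP (uv m) (uv n)).
    rewrite mulrC.
    have -> : v m - v n + (u m - v m - (u n - v n)) = u m - u n.
      by rewrite addrACA -opprD !subrKC.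
    rewrite ler_wpM2l ?rnorm_ge0//.
    by rewrite (le_trans (ler_norm M))// lerDl.
  exists l => //; exists p => // w Ww.
  apply: (dot_cvgl_eq0 dotn (u_ := fun n => u n - v n)) => [|n]; last exact: uv.
  exact: cvgB.
have [w [v Vv wv] xw] := orthogonal_projection x sU cU.
suff xw0 : x - w = 0.
  by exists v => //; move/eqP: xw0; rewrite subr_eq0 => /eqP ->.
have : (W `&` V^⊥) (x - w).
  split; last by move=> y /VU; exact: xw.
  apply: orthogonal_complementK => // y /PU; exact: xw.
by rewrite WV0.
Qed.

End Projection.

(** * Passing between the operator norm and pointwise bounds *)

Section OperatorNorm.
Variables (R : realType) (k : scalar_kind).
Local Notation K := (scalars R k).
Local Notation rs := (real_scalar k).
Variables (X Y : lmodType K) (nX : X -> R) (nY : Y -> R) (T : X -> Y) (M : R).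

Lemma opnorm_le : (forall x, nX x <= 1 -> nY (T x) <= M) ->
  (opnorm nX nY T <= M%:E)%E.
Proof.
by move=> h; apply: ge_ereal_sup => _ [x /= /h Mx <-]; rewrite lee_fin.
Qed.

(** Homogeneity is asked at the single point [x], so that the bound applies to an error map built
    from [oblique_proj] at a point known to decompose, before the direct sum is established. *)
Lemma le_opnorm (x : X) : 0 <= nX x ->
  (forall r, 0 < r -> nX (rs r *: x) = r * nX x) ->
  (forall r, 0 < r -> nY (T (rs r *: x)) = r * nY (T x)) ->
  (opnorm nX nY T <= M%:E)%E -> nY (T x) <= M * nX x.
Proof.
move=> x0 hX hY TM; apply/ler_addgt0Pr => e e0.
have M1 : 0 < `|M| + 1 by rewrite ltr_wpDl.
(* The added term keeps the scaling factor positive when [nX x] is 0 and costs at most [e]. *)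
set s := nX x + e / (`|M| + 1).
have s0 : 0 < s by rewrite ltr_wpDl// divr_gt0.
have : nY (T (rs s^-1 *: x)) <= M.
  rewrite -lee_fin; apply: le_trans TM; apply: ereal_sup_ubound => /=.
  exists (rs s^-1 *: x) => //=; rewrite hX ?invr_gt0// mulrC ler_pdivrMr// mul1r.
  by rewrite lerDl divr_ge0// ltW.
rewrite hY ?invr_gt0// mulrC ler_pdivrMr// => /le_trans; apply.
rewrite mulrDr lerD2l mulrA ler_pdivrMr// mulrC ler_wpM2l ?(ltW e0)//.
by rewrite (le_trans (ler_norm M))// lerDl.
Qed.

End OperatorNorm.

(** * Norm and truncations in the space of square summable sequences *)

Section SquareSummableSequences.
Variables (R : realType) (k : scalar_kind).
Local Notation K := (scalars R k).
Implicit Types (c d : ell2 R k) (s : nat -> K).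

Lemma sqsum_ge0 s : (0 <= sqsum s)%E.
Proof. by apply: nneseries_ge0 => n _ _; rewrite lee_fin sqr_ge0. Qed.

Lemma sqsum_le s (M : R) :
  (forall n, \sum_(0 <= i < n) rnorm (s i) ^+ 2 <= M) -> (sqsum s <= M%:E)%E.
Proof.
move=> h; apply: lime_le.
  by apply: is_cvg_nneseries => n _ _; rewrite lee_fin sqr_ge0.
by apply: nearW => n; rewrite sumEFin lee_fin.
Qed.

Lemma partial_sum_le_sqsum s m n :
  ((\sum_(m <= i < n) rnorm (s i) ^+ 2)%:E <= sqsum s)%E.
Proof.
apply: (@le_trans _ _ (\sum_(0 <= i < n) rnorm (s i) ^+ 2)%:E).
  rewrite lee_fin; have [mn|nm] := leqP m n.
    by rewrite (@big_cat_nat _ _ _ m 0 n)//= lerDr sumr_ge0// => i _; exact: sqr_ge0.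
  by rewrite big_geq ?(ltnW nm)// sumr_ge0// => i _; exact: sqr_ge0.
rewrite -sumEFin; apply: nneseries_lim_ge => i _ _.
by rewrite lee_fin sqr_ge0.
Qed.

Lemma sqsum_ell2 c : sqsum c = (ell2_norm c ^+ 2)%:E.
Proof.
have c0 := sqsum_ge0 c.
have /asboolP cfin : ell2_seq c \in @sqsummable R k := ell2P c.
by rewrite /ell2_norm sqr_sqrtr ?fine_ge0// fineK// ge0_fin_numE.
Qed.

Lemma ell2_norm_ge0 c : 0 <= ell2_norm c.
Proof. exact: sqrtr_ge0. Qed.

Lemma ell2_norm_sqr_le c (M : R) :
  (forall n, \sum_(0 <= i < n) rnorm (c i) ^+ 2 <= M) -> ell2_norm c ^+ 2 <= M.
Proof. by move=> /sqsum_le; rewrite sqsum_ell2 lee_fin. Qed.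

Lemma partial_sum_le_ell2_norm c m n :
  \sum_(m <= i < n) rnorm (c i : K) ^+ 2 <= ell2_norm c ^+ 2.
Proof.
by have := partial_sum_le_sqsum (c : nat -> K) m n; rewrite sqsum_ell2 lee_fin.
Qed.

Lemma ell2_normZ (a : K) c : ell2_norm (a *: c) = rnorm a * ell2_norm c.
Proof.
apply/eqP; rewrite -(eqrXn2 (n := 2))// ?mulr_ge0 ?ell2_norm_ge0 ?rnorm_ge0//.
apply/eqP/EFin_inj; rewrite exprMn [RHS]EFinM -!sqsum_ell2 /sqsum -nneseriesZl.
  by apply: eq_eseriesr => i _; rewrite -EFinM -exprMn -rnormM.
by move=> n _; rewrite lee_fin sqr_ge0.
Qed.

(** Written as a combination of the [delta], so that a linear map sends it to a finite sum; [s] is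
    any sequence, square summable or not. *)
Definition truncation s n : ell2 R k := \sum_(0 <= i < n) s i *: delta R k i.

Lemma truncationE s n j : truncation s n j = if (j < n)%N then s j else 0.
Proof.
rewrite /truncation (big_morph (fun c => (c : nat -> K) j) (id1 := 0) (op1 := +%R))//.
have h i : (s i *: delta R k i : nat -> K) j = if i == j then s i else 0.
  have -> : (s i *: delta R k i : nat -> K) j = s i * (j == i)%:R by [].
  by rewrite eq_sym; case: eqP; rewrite ?mulr1 ?mulr0.
under eq_bigr do rewrite h.
case: ltnP => jn; last first.
  rewrite big_nat big1// => i /andP[_ ij].
  by rewrite (ltn_eqF (leq_trans ij jn)).
rewrite (@big_cat_nat _ _ _ j.+1)//= big_nat_recr//= eqxx.
rewrite big_nat big1 ?add0r; last by move=> i /andP[_ ij]; rewrite ltn_eqF.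
rewrite [X in _ + X]big_nat big1 ?addr0// => i /andP[ij _].
by rewrite gtn_eqF.
Qed.

Lemma truncation_tailE c n j :
  (c - truncation c n) j = if (j < n)%N then 0 else c j.
Proof.
have -> : (c - truncation c n) j = c j - truncation c n j by [].
by rewrite truncationE; case: ltnP; rewrite ?subrr ?subr0.
Qed.

Lemma ell2_norm_truncation s n :
  ell2_norm (truncation s n) ^+ 2 <= \sum_(0 <= i < n) rnorm (s i) ^+ 2.
Proof.
have ge0 (I : nat -> K) m p : 0 <= \sum_(m <= i < p) rnorm (I i) ^+ 2.
  by rewrite sumr_ge0// => i _; exact: sqr_ge0.
apply: ell2_norm_sqr_le => m.
apply: (@le_trans _ _ (\sum_(0 <= i < maxn n m) rnorm (truncation s n i : K) ^+ 2)).
  by rewrite [leRHS](@big_cat_nat _ _ _ m)//= ?leq_maxr// lerDl.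
rewrite (@big_cat_nat _ _ _ n)//= ?leq_maxl//.
rewrite [X in _ + X]big_nat [X in _ + X]big1 ?addr0; last first.
  by move=> i /andP[ni _]; rewrite truncationE ltnNge ni/= rnorm0 expr0n.
rewrite big_nat [leRHS]big_nat; apply: ler_sum => i /andP[_ ni].
by rewrite truncationE ni.
Qed.

(** The squared norm is the tail of a convergent series, and the square root is continuous at 0. *)
Lemma truncation_cvg c :
  ell2_norm (c - truncation c n) @[n --> \oo] --> (0 : R).
Proof.
have h : (\sum_(n <= i <oo) (rnorm (c i : K) ^+ 2)%:E @[n --> \oo] --> 0%:E)%E.
  apply: (@nneseries_tail_cvg R (fun i => (rnorm (c i : K) ^+ 2)%:E) xpredT).
    by have := ltry (ell2_norm c ^+ 2); rewrite -sqsum_ell2.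
  by move=> i _; rewrite lee_fin sqr_ge0.
have /(cvg_comp _ _ (fine_cvg h)) : Num.sqrt x @[x --> (0 : R)] --> (0 : R).
  by have := @sqrt_continuous R 0; rewrite /continuous_at sqrtr0.
apply: cvg_trans; apply: near_eq_cvg; apply: nearW => n /=.
rewrite /ell2_norm; congr (Num.sqrt (fine _)).
rewrite /sqsum (@nneseries_split _ _ 0%N n)//; last first.
  by move=> i _; rewrite lee_fin sqr_ge0.
rewrite add0n big_nat big1 ?add0e; last first.
  by move=> i /andP[_ ni]; rewrite truncation_tailE ni rnorm0 expr0n.
rewrite eseries_cond [RHS]eseries_cond; apply: eq_eseriesr => i.
by rewrite andTb => ni; rewrite truncation_tailE ltnNge ni.
Qed.

End SquareSummableSequences.

(** * Bessel sequences, their synthesis and analysis operators, and adjoints *)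

Section Bessel.
Variables (R : realType) (k : scalar_kind).
Local Notation K := (scalars R k).
Variable H : completeNormedModType K.
Variable dot : {dot H for conjugation R k}.
Hypothesis dotn : induces_norm dot.
Local Notation conj := (conjugation R k).
Implicit Types (F G : nat -> H) (c : ell2 R k) (B M : R).

(** Unlike the upper bound in [is_frame], this ranges over the whole of [H]; partial sums keep it an
    inequality over R. *)
Definition bessel G B := forall f n,
  \sum_(0 <= i < n) rnorm (dot f (G i)) ^+ 2 <= B * rnorm f ^+ 2.

Lemma dot_sumr f (s : nat -> K) G m n :
  dot f (\sum_(m <= i < n) s i *: G i) =
  \sum_(m <= i < n) conj (s i) * dot f (G i).
Proof. by rewrite linear_sumr; apply: eq_bigr => i _; exact: dotZr. Qed.

Lemma dot_suml f (s : nat -> K) G m n :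
  dot (\sum_(m <= i < n) s i *: G i) f = \sum_(m <= i < n) s i * dot (G i) f.
Proof. by rewrite linear_sumlz; apply: eq_bigr => i _; exact: dotZl. Qed.

(** Expand the squared norm of [u] as a sum of products and apply [2ab <= B a^2 + b^2 / B] to each.
    The Bessel bound is used at [u] only, so a bound valid on a subspace containing [u] suffices. *)
Lemma rnorm_sum_scale_le (s : nat -> K) G B m n : 0 < B ->
  let u := \sum_(m <= i < n) s i *: G i in
  \sum_(m <= i < n) rnorm (dot u (G i)) ^+ 2 <= B * rnorm u ^+ 2 ->
  rnorm u ^+ 2 <= B * \sum_(m <= i < n) rnorm (s i) ^+ 2.
Proof.
move=> B0 u uB.
have : 2 * rnorm u ^+ 2 <= B * (\sum_(m <= i < n) rnorm (s i) ^+ 2) +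
    B^-1 * (\sum_(m <= i < n) rnorm (dot u (G i)) ^+ 2).
  rewrite -(realpart_dotxx dotn) {2}/u dot_sumr realpart_sum !mulr_sumr -big_split/=.
  apply: ler_sum => i _.
  apply: (@le_trans _ _ (2 * (rnorm (s i) * rnorm (dot u (G i))))).
    by rewrite ler_pM2l// (le_trans (realpart_le_rnorm _))// rnormM rnorm_conj.
  move: (rnorm (s i)) (rnorm (dot u (G i))) => a b.
  rewrite -subr_ge0.
  have -> : B * a ^+ 2 + B^-1 * b ^+ 2 - 2 * (a * b) = B * (a - B^-1 * b) ^+ 2.
    by field; rewrite gt_eqF.
  by rewrite mulr_ge0 ?sqr_ge0// ltW.
have : B^-1 * (\sum_(m <= i < n) rnorm (dot u (G i)) ^+ 2) <= rnorm u ^+ 2.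
  by rewrite mulrC ler_pdivrMr// mulrC.
set S := B * _; set S' := B^-1 * _; lra.
Qed.

(** With [u] the sum synthesized from the coefficients of [f], the sum [S] of their squared moduli
    is [dot f u]. Then [2 S <= B |f|^2 + |u|^2 / B], and the last term is at most [S]. *)
Lemma bessel_of_synthesis G B : 0 < B ->
  (forall f n, let s i := dot f (G i) in
    rnorm (\sum_(0 <= i < n) s i *: G i) ^+ 2 <=
    B * \sum_(0 <= i < n) rnorm (s i) ^+ 2) ->
  bessel G B.
Proof.
move=> B0 h f n; have := h f n; rewrite /=; set u := \sum_(_ <= _ < _) _ *: _.
set S := \sum_(_ <= _ < _) _ => uS.
have : S <= rnorm f * rnorm u.
  apply: le_trans (CauchySchwarz_rnorm dotn f u).
  apply: le_trans (realpart_le_rnorm _).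
  rewrite dot_sumr realpart_sum; apply: ler_sum => i _.
  by rewrite mulrC mul_conj realpart_real.
have : rnorm u ^+ 2 / B <= S by rewrite ler_pdivrMr// mulrC.
have : 2 * (rnorm f * rnorm u) <= B * rnorm f ^+ 2 + rnorm u ^+ 2 / B.
  move: (rnorm f) (rnorm u) => a b; rewrite -subr_ge0.
  have -> : B * a ^+ 2 + b ^+ 2 / B - 2 * (a * b) = B * (a - B^-1 * b) ^+ 2.
    by field; rewrite gt_eqF.
  by rewrite mulr_ge0 ?sqr_ge0// ltW.
move: {uS} S (rnorm f * rnorm u) (B * _) (_ / B) => S p a b; lra.
Qed.

(** The frame bound is given on [U] only. Finite syntheses lie in [U], so it bounds them, and
    [bessel_of_synthesis] carries the estimate to all of [H]. *)
Lemma frame_bessel (U : set H) F : subspace U -> is_frame dot U F ->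
  exists2 B, 0 < B & bessel F B.
Proof.
move=> sU [UF [a [B [a0 aB fr]]]]; have B0 := lt_le_trans a0 aB.
exists B => //; apply: (bessel_of_synthesis B0) => f n; set s := fun i => dot f (F i).
rewrite /=.
apply: (rnorm_sum_scale_le B0).
rewrite -lee_fin; apply: le_trans (proj2 (fr _ _)).
  exact: partial_sum_le_sqsum.
by apply: subspace_sum => // i; exact: subspaceZ.
Qed.

(** Finite syntheses of the images of the [delta] are values of [A] at truncations. *)
Lemma operator_bessel (A : {linear ell2 R k -> H}) M : 0 < M ->
  (forall c, rnorm (A c) <= M * ell2_norm c) ->
  bessel (fun n => A (delta R k n)) (M ^+ 2).
Proof.
move=> M0 AM; apply: bessel_of_synthesis => [|f n /=]; first exact: exprn_gt0.
set s := fun i => dot f (A (delta R k i)).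
have -> : \sum_(0 <= i < n) s i *: A (delta R k i) = A (truncation s n).
  by rewrite linear_sum; apply: eq_bigr => i _; rewrite linearZ.
apply: (@le_trans _ _ ((M * ell2_norm (truncation s n)) ^+ 2)).
  by rewrite ler_pXn2r ?nnegrE ?rnorm_ge0// mulr_ge0 ?ell2_norm_ge0// ltW.
by rewrite exprMn ler_wpM2l ?sqr_ge0// ell2_norm_truncation.
Qed.

(** A block of the series beyond [N] involves only entries of [c - truncation c N], so
    [rnorm_sum_scale_le] makes the partial sums Cauchy. *)
Lemma synthesis_cvg G B c : 0 < B -> bessel G B ->
  series (fun n => c n *: G n) @ \oo --> synthesis G c.
Proof.
move=> B0 GB.
suff [l] : exists l : H, series (fun n => c n *: G n) @ \oo --> l.
  by move=> ul; exact: (cvgP l ul).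
have tail : B * (ell2_norm (c - truncation c n) * ell2_norm (c - truncation c n))
    @[n --> \oo] --> (0 : R).
  rewrite -(mulr0 B) -[X in _ * X](mulr0 0).
  by apply: cvgM; [exact: cvg_cst|apply: cvgM; exact: truncation_cvg].
apply: rnorm_cauchy_cvg => e e0.
have [N _ hN] := (@cvgrPdist_lt _ _ _ _ _ _ _).1 tail (e ^+ 2) (exprn_gt0 2 e0).
exists N.
have sym (P : nat -> nat -> Prop) : (forall m n, P m n -> P n m) ->
    (forall m n, (N <= m)%N -> (m <= n)%N -> P n m) ->
    forall m n, (N <= m)%N -> (N <= n)%N -> P m n.
  move=> Ps h m n Nm Nn; have [mn|nm] := leqP m n; first by apply: Ps; exact: h.
  by apply: h => //; exact: ltnW.
apply: sym => [m n|m n Nm mn]; first by rewrite rnormC.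
rewrite sub_series_geq// -(ltr_pXn2r (n := 2))// ?nnegrE ?rnorm_ge0 ?(ltW e0)//.
have := hN N (leqnn N).
rewrite /= sub0r normrN ger0_norm ?mulr_ge0 ?ell2_norm_ge0 ?(ltW B0)//.
apply: le_lt_trans; rewrite -expr2.
have h (f : H) : \sum_(m <= i < n) rnorm (dot f (G i)) ^+ 2 <= B * rnorm f ^+ 2.
  apply: le_trans (GB f n); rewrite [leRHS](@big_cat_nat _ _ _ m)//= lerDr.
  by apply: sumr_ge0 => i _; exact: sqr_ge0.
apply: le_trans (rnorm_sum_scale_le B0 (h _)) _.
rewrite ler_pM2l//; apply: le_trans (partial_sum_le_ell2_norm _ m n).
rewrite big_nat [leRHS]big_nat; apply: ler_sum => i /andP[mi _].
by rewrite truncation_tailE ltnNge (leq_trans Nm mi).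
Qed.

Lemma synthesis_is_linear G B : 0 < B -> bessel G B ->
  linear (synthesis G : ell2 R k -> H).
Proof.
move=> B0 GB a c d; rewrite /synthesis; apply: cvg_lim => //.
have -> : series (fun n => (a *: c + d) n *: G n) =
    (fun n => a *: series (fun n => c n *: G n) n
              + series (fun n => d n *: G n) n).
  apply/funext => n; rewrite /series /= scaler_sumr -big_split/=.
  by apply: eq_bigr => i _; rewrite scalerA -scalerDl.
apply: cvgD; last exact: (synthesis_cvg B0 GB).
by apply: cvgZl_tmp; exact: (synthesis_cvg B0 GB).
Qed.

Lemma synthesis_le G B c : 0 < B -> bessel G B ->
  rnorm (synthesis G c) <= Num.sqrt B * ell2_norm c.
Proof.
move=> B0 GB; have /cvg_rnormP sc := @synthesis_cvg G B c B0 GB.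
(* The excess over the claimed bound is at most the distance to the [n]-th partial sum, which
   already obeys it. *)
rewrite -subr_le0; apply: (le0_cvg0 (M := 1) sc) => n.
rewrite mul1r lerBlDr rnormC.
rewrite -[X in rnorm X](subrK (series (fun n => c n *: G n) n)).
rewrite (le_trans (rnormD _ _))// lerD2l.
rewrite -(ler_pXn2r (n := 2))// ?nnegrE ?rnorm_ge0//; last first.
  by rewrite mulr_ge0 ?sqrtr_ge0 ?ell2_norm_ge0.
rewrite exprMn sqr_sqrtr ?(ltW B0)//.
apply: le_trans (rnorm_sum_scale_le B0 (GB _ n)) _.
by rewrite ler_pM2l// partial_sum_le_ell2_norm.
Qed.

Lemma synthesis_closed (U : set H) G B c : 0 < B -> bessel G B ->
  closed_subspace U -> (forall n, U (G n)) -> U (synthesis G c).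
Proof.
move=> B0 GB cU UG; have sU := closed_subspace_subspace cU.
apply: (closed_cvg _ (proj1 cU) _ _ (@synthesis_cvg G B c B0 GB)); apply: nearW => n.
by apply: subspace_sum => // i; exact: subspaceZ.
Qed.

Lemma synthesis_delta G n : synthesis G (delta R k n) = G n.
Proof.
apply: lim_near_cst => //; exists n.+1 => //= m /= nm.
rewrite /series /= (@big_cat_nat _ _ _ n.+1)//= big_nat_recr//= eqxx scale1r.
rewrite big_nat big1 ?add0r; last first.
  by move=> i /andP[_ ij]; rewrite ltn_eqF// scale0r.
rewrite big_nat big1 ?addr0// => i /andP[ij _].
by rewrite gtn_eqF// scale0r.
Qed.

(** Partial sums of the series are values of [A] at truncations of [c], which converge to [c]. Thus
    a bounded [A] is the synthesis operator of its values at the [delta]. *)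
Lemma operator_synthesis (A : {linear ell2 R k -> H}) M c :
  (forall d, rnorm (A d) <= M * ell2_norm d) ->
  synthesis (fun n => A (delta R k n)) c = A c.
Proof.
move=> AM; apply: cvg_lim => //; apply/cvg_rnormP.
have h : M * ell2_norm (c - truncation c n) @[n --> \oo] --> (M * 0 : R).
  by apply: cvgM; [exact: cvg_cst|exact: truncation_cvg].
rewrite mulr0 in h.
apply: (squeeze_cvgr _ (cvg_cst (0 : R)) h); apply: nearW => n.
rewrite rnorm_ge0 /= rnormC.
have -> : series (fun n => c n *: A (delta R k n)) n = A (truncation c n).
  by rewrite linear_sum; apply: eq_bigr => i _; rewrite linearZ.
by rewrite -linearB AM.
Qed.

Section Analysis.
Variables (G : nat -> H) (B : R).
Hypothesis GB : bessel G B.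

(** The Bessel bound makes the coefficients square summable, so the default value in [analysis] is
    not taken. *)
Lemma analysisE f n : analysis dot G f n = dot f (G n).
Proof.
rewrite /analysis insubdK//; apply/asboolP.
apply: (@le_lt_trans _ _ (B * rnorm f ^+ 2)%:E); last exact: ltry.
by apply: sqsum_le => m; exact: GB.
Qed.

Lemma analysis_le f : ell2_norm (analysis dot G f) ^+ 2 <= B * rnorm f ^+ 2.
Proof.
apply: ell2_norm_sqr_le => n; apply: le_trans (GB f n).
by apply: ler_sum => i _; rewrite analysisE.
Qed.

Lemma analysis_rnorm_le f :
  ell2_norm (analysis dot G f) <= Num.sqrt B * rnorm f.
Proof.
rewrite -(ler_pXn2r (n := 2))// ?nnegrE ?ell2_norm_ge0//; last first.
  by rewrite mulr_ge0 ?sqrtr_ge0 ?rnorm_ge0.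
apply: le_trans (analysis_le f) _; rewrite exprMn ler_wpM2r ?sqr_ge0//.
have [B0|B0] := leP 0 B; first by rewrite sqr_sqrtr.
by rewrite (le_trans (ltW B0))// sqr_ge0.
Qed.

Lemma sqsum_analysis f :
  sqsum (fun n => dot f (G n)) = (ell2_norm (analysis dot G f) ^+ 2)%:E.
Proof.
rewrite -sqsum_ell2; congr sqsum.
by apply/funext => n; rewrite analysisE.
Qed.

Lemma analysisZ a f : analysis dot G (a *: f) = a *: analysis dot G f.
Proof.
apply: val_inj; apply/funext => n.
have -> : \val (a *: analysis dot G f) n = a * analysis dot G f n by [].
by rewrite /= !analysisE dotZl.
Qed.

End Analysis.

(** The two sides agree exactly at each partial sum ([sFG]); continuity of the inner product gives
    the limit. *)
Lemma frame_operator_adjoint F G BF BG f y : 0 < BF -> 0 < BG ->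
  bessel F BF -> bessel G BG ->
  dot f (synthesis G (analysis dot F y)) =
  dot (synthesis F (analysis dot G f)) y.
Proof.
move=> BF0 BG0 hF hG; apply/eqP; rewrite -subr_eq0 -rnorm_eq0 eq_le rnorm_ge0 andbT.
have := dot_cvgl dotn f (@synthesis_cvg G BG (analysis dot F y) BG0 hG).
have := dot_cvgl dotn y (@synthesis_cvg F BF (analysis dot G f) BF0 hF).
move=> /cvgD /[apply]; rewrite addr0 => h.
apply: (le0_cvg0 (M := 1) h) => n; rewrite mul1r /=.
set sG := series (fun i => analysis dot F y i *: G i) n.
set sF := series (fun i => analysis dot G f i *: F i) n.
have sFG : dot f sG = dot sF y.
  rewrite /sG /sF /series /= dot_sumr dot_suml; apply: eq_bigr => i _.
  by rewrite (analysisE hF) (analysisE hG) -dotC mulrC.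
set a := dot f _; set b := dot _ y.
have -> : a - b = (dot sF y - b) - (dot f sG - a) by rewrite sFG; ring.
apply: le_trans (rnormD _ _) _; rewrite rnormN lerD2l.
by rewrite -rnorm_conj rmorphB/= /a -!dotC.
Qed.

(** Take [y = E f] in the adjoint relation, apply Cauchy-Schwarz and cancel one factor
    [rnorm (E f)]. *)
Lemma adjoint_le (E D : H -> H) M :
  (forall f y, dot (E f) y = dot f (D y)) ->
  (forall y, rnorm (D y) <= M * rnorm y) ->
  forall f, rnorm (E f) <= M * rnorm f.
Proof.
move=> ED DM f; have [->|E0] := eqVneq (E f) 0.
  by rewrite rnorm0V (le_trans (rnorm_ge0 (D f)))// DM.
have e0 : 0 < rnorm (E f) by rewrite lt_def rnorm_eq0 E0 rnorm_ge0.
rewrite -(ler_pM2r e0) -expr2 -(realpart_dotxx dotn) ED.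
rewrite (le_trans (realpart_le_rnorm _))// (le_trans (CauchySchwarz_rnorm dotn _ _))//.
by rewrite mulrAC [leRHS]mulrC ler_wpM2l ?rnorm_ge0.
Qed.

End Bessel.

(** * Oblique projections, the dual direct sum, and the adjoint of the error *)

Section ObliqueProjection.
Variables (R : realType) (k : scalar_kind).
Local Notation K := (scalars R k).
Variable H : completeNormedModType K.
Variable dot : {dot H for conjugation R k}.
Hypothesis dotn : induces_norm dot.
Local Notation "U ^⊥" := (orthogonal_complement dot U)
  (at level 1, format "U ^⊥").
Implicit Types (U V W : set H).

(** Only [x] is required to decompose, so [oblique_proj] can be evaluated before [U + U'] is known
    to be the whole space. *)
Lemma oblique_proj_eq U (U' : set H) x u : subspace U -> subspace U' ->
  U `&` U' = [set 0] -> U u -> U' (x - u) -> oblique_proj U U' x = u.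
Proof.
move=> sU sU' UU' Uu xu; apply: xget_subset1 => //.
move=> v w [Uv xv] [Uw xw].
have : (U `&` U') (v - w).
  split; first exact: subspaceB.
  have -> : v - w = (x - w) - (x - v) by rewrite opprB [RHS]addrC subrKA.
  exact: subspaceB.
by rewrite UU' => /eqP; rewrite subr_eq0 => /eqP.
Qed.

Lemma oblique_proj_mem U (U' : set H) x : direct_sum U U' ->
  U (oblique_proj U U' x) /\ U' (x - oblique_proj U U' x).
Proof.
move=> [h _]; have [u [u' [Uu Uu' xE]]] := h x.
have hu : [set u | U u /\ U' (x - u)] u by split=> //; rewrite xE addrC addKr.
exact: (xgetI 0 hu).
Qed.

Lemma oblique_projZ U (U' : set H) a x : subspace U -> subspace U' -> direct_sum U U' ->
  oblique_proj U U' (a *: x) = a *: oblique_proj U U' x.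
Proof.
move=> sU sU' UU'; have [p xp] := oblique_proj_mem x UU'.
apply: oblique_proj_eq => //; first by case: UU'.
  exact: subspaceZ.
by rewrite -scalerBr; exact: subspaceZ.
Qed.

(** A vector of the intersection is orthogonal to both of its components in [W] and [V^⊥], hence to
    itself. *)
Lemma dual_disjoint W V : subspace V -> direct_sum W V^⊥ ->
  V `&` W^⊥ = [set 0].
Proof.
move=> sV [WVT _]; apply/seteqP; split=> [v [Vv Wv]|_ ->]; last first.
  by split; [case: sV|case: (orthogonal_complement_subspace dot W)].
have [w [z [Ww Vz vE]]] := WVT v.
apply/eqP; rewrite -rnorm_eq0 -[_ == 0]sqrf_eq0 -(realpart_dotxx dotn).
rewrite {2}vE dotDr Wv// (dot_eq0C (Vz _ Vv)) addr0.
by rewrite /realpart; case: (k).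
Qed.

Lemma dual_direct_sum W V (M : R) : closed_subspace W -> closed_subspace V ->
  direct_sum W V^⊥ ->
  (forall v z, V v -> W^⊥ z -> rnorm v <= M * rnorm (v + z)) ->
  direct_sum V W^⊥.
Proof.
move=> cW cV WV vM.
have sW := closed_subspace_subspace cW; have sV := closed_subspace_subspace cV.
split=> [x|]; last exact: dual_disjoint.
have [v Vv xv] := dual_decomposition dotn sW
  (closed_sequentially_complete (proj1 cW)) sV
  (closed_sequentially_complete (proj1 cV)) (proj2 WV) vM x.
by exists v, (x - v); split=> //; rewrite subrKC.
Qed.

(** Both sides equal the inner product of the two projections, the remainders lying in [V^⊥] and
    [W^⊥]. *)
Lemma oblique_proj_adjoint W V f y : direct_sum W V^⊥ -> direct_sum V W^⊥ ->
  dot (oblique_proj W V^⊥ f) y = dot f (oblique_proj V W^⊥ y).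
Proof.
move=> WV VW; have [Ww fw] := oblique_proj_mem f WV.
have [Vv yv] := oblique_proj_mem y VW.
set w := oblique_proj W _ f in Ww fw *; set v := oblique_proj V _ y in Vv yv *.
rewrite -[y in LHS](subrK v) -[f in RHS](subrK w) dotDr dotDl.
by rewrite fw// (dot_eq0C (yv _ Ww)).
Qed.

Lemma synthesis_linear G (B : R) : 0 < B -> bessel dot G B ->
  exists A : {linear ell2 R k -> H}, forall c, A c = synthesis G c.
Proof.
move=> B0 GB; have lin := synthesis_is_linear dotn B0 GB.
pose A : {linear ell2 R k -> H} :=
  HB.pack (synthesis G : ell2 R k -> H) (GRing.isLinear.Build _ _ _ _ _ lin).
by exists A.
Qed.

Lemma oblique_error_adjoint W V F G BF BG f y : 0 < BF -> 0 < BG ->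
  bessel dot F BF -> bessel dot G BG ->
  direct_sum W V^⊥ -> direct_sum V W^⊥ ->
  dot (oblique_proj W V^⊥ f - synthesis F (analysis dot G f)) y =
  dot f (oblique_proj V W^⊥ y - synthesis G (analysis dot F y)).
Proof.
move=> BF0 BG0 hF hG WV VW.
rewrite dotBl dotBr oblique_proj_adjoint//.
by rewrite (frame_operator_adjoint dotn f y BF0 BG0 hF hG).
Qed.

End ObliqueProjection.

(** * The two inclusions between dual frames and left inverses *)

Section Characterization.
Variables (R : realType) (k : scalar_kind).
Local Notation K := (scalars R k).
Variable H : completeNormedModType K.
Variable dot : {dot H for conjugation R k}.
Hypothesis dotn : induces_norm dot.
Local Notation rs := (real_scalar k).
Local Notation "U ^⊥" := (orthogonal_complement dot U)
  (at level 1, format "U ^⊥").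
Variables (W V : set H) (F : nat -> H) (eps : R).
Hypotheses (cW : closed_subspace W) (cV : closed_subspace V).
Hypotheses (WV : direct_sum W V^⊥) (frF : is_frame dot W F).
Hypotheses (eps0 : 0 <= eps).

Let sW : subspace W := closed_subspace_subspace cW.
Let sV : subspace V := closed_subspace_subspace cV.
Let sVP : subspace V^⊥ := orthogonal_complement_subspace dot V.
Let sWP : subspace W^⊥ := orthogonal_complement_subspace dot W.

Lemma rnorm_real_scalarZ r (x : H) : 0 < r -> rnorm (rs r *: x) = r * rnorm x.
Proof. by move=> r0; rewrite rnormZ rnorm_real// ltW. Qed.

Lemma approx_dual_left_inverse G : approx_oblique_dual dot eps W V F G ->
  exists A : {linear ell2 R k -> H},
    approx_oblique_left_inverse dot eps W V F A /\
    G = (fun n => A (delta R k n)).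
Proof.
move=> [_ frG Geps].
have [BF BF0 hF] := frame_bessel dotn sW frF.
have [BG BG0 hG] := frame_bessel dotn sV frG.
have [TF TFE] := synthesis_linear dotn BF0 hF.
have [TG TGE] := synthesis_linear dotn BG0 hG.
pose E f := oblique_proj W V^⊥ f - synthesis F (analysis dot G f).
have Eeps f : rnorm (E f) <= eps * rnorm f.
  apply: (le_opnorm (T := E)) Geps; first exact: rnorm_ge0.
    by move=> r; exact: rnorm_real_scalarZ.
  move=> r r0; rewrite -rnorm_real_scalarZ//; congr rnorm.
  by rewrite /E oblique_projZ// (analysisZ hG) -!TFE linearZ scalerBr.
(* The projection is the error plus [synthesis F] after [analysis dot G]; the summands bound these
   two. *)
pose M := eps + Num.sqrt BF * Num.sqrt BG.
have M0 : 0 <= M by rewrite addr_ge0// mulr_ge0 ?sqrtr_ge0.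
have piM f : rnorm (oblique_proj W V^⊥ f) <= M * rnorm f.
  rewrite -[oblique_proj _ _ _](subrK (synthesis F (analysis dot G f))) mulrDl.
  apply: le_trans (rnormD _ _) (lerD (Eeps f) _).
  apply: le_trans (synthesis_le dotn _ BF0 hF) _.
  by rewrite -mulrA ler_wpM2l ?sqrtr_ge0// (analysis_rnorm_le hG).
have VW : direct_sum V W^⊥.
  apply: (dual_direct_sum dotn cW cV WV (M := M)) => v z Vv Wz.
  have [->|v0] := eqVneq v 0; first by rewrite rnorm0V mulr_ge0 ?rnorm_ge0.
  have vp : 0 < rnorm v by rewrite lt_def rnorm_eq0 v0 rnorm_ge0.
  have [Ww vw] := oblique_proj_mem v WV.
  rewrite -(ler_pM2l vp) -expr2 -(realpart_dotxx dotn).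
  (* The difference between [v] and its projection is in [V^⊥], hence orthogonal to [v], while [z]
     is orthogonal to the projection, which is in [W]. *)
  have -> : dot v v = dot (oblique_proj W V^⊥ v) (v + z).
    rewrite dotDr (dot_eq0C (Wz _ Ww)) addr0; apply/eqP.
    by rewrite -subr_eq0 -dotBl vw.
  apply: le_trans (realpart_le_rnorm _) _.
  apply: le_trans (CauchySchwarz_rnorm dotn _ _) _.
  by rewrite mulrA ler_wpM2r ?rnorm_ge0// mulrC piM.
exists TG; split; last by apply/funext => n; rewrite TGE synthesis_delta.
split=> [c||].
- by rewrite TGE; exact: (synthesis_closed dotn c BG0 hG cV (proj1 frG)).
- apply: (@le_lt_trans _ _ (Num.sqrt BG)%:E); last exact: ltry.
  apply: opnorm_le => c c1; rewrite TGE.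
  apply: le_trans (synthesis_le dotn c BG0 hG) _.
  by rewrite -[leRHS]mulr1 ler_wpM2l ?sqrtr_ge0.
- apply: opnorm_le => y y1; rewrite TGE.
  apply: (@le_trans _ _ (eps * rnorm y)); last first.
    by rewrite -[leRHS]mulr1 ler_wpM2l.
  apply: (adjoint_le dotn (D := E) (E := fun y =>
    oblique_proj V W^⊥ y - synthesis G (analysis dot F y))) => // {y1}{}y f.
  by apply: esym; rewrite dotC (oblique_error_adjoint dotn _ _ BF0 BG0 hF hG)// -dotC.
Qed.

Lemma left_inverse_approx_dual (A : {linear ell2 R k -> H}) : eps < 1 ->
  approx_oblique_left_inverse dot eps W V F A ->
  approx_oblique_dual dot eps W V F (fun n => A (delta R k n)).
Proof.
move=> eps1 [VA Afin Aeps]; set G := fun n => A (delta R k n).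
have [BF BF0 hF] := frame_bessel dotn sW frF.
have [M M0 AM] : exists2 M, 0 < M & forall c, rnorm (A c) <= M * ell2_norm c.
  (* The supremum is replaced by a positive real bound: the maximum with 1 if it is finite, and 1 in
     the formal case of minus infinity. *)
  have [M M0 AM] : exists2 M : R, 0 < M &
      (opnorm (@ell2_norm R k) (@rnorm R k H) A <= M%:E)%E.
    move: Afin; case: opnorm => [r _||] //; last first.
      by exists 1 => //; rewrite leNye.
    by exists (Num.max 1 r); rewrite ?lt_max ?ltr01// lee_fin le_max lexx orbT.
  exists M => // c; apply: le_opnorm AM; first exact: ell2_norm_ge0.
    by move=> r r0; rewrite ell2_normZ rnorm_real// ltW.
  by move=> r r0; rewrite linearZ rnorm_real_scalarZ.
have hG : bessel dot G (M ^+ 2) by exact: operator_bessel.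
have BG0 : 0 < M ^+ 2 by rewrite exprn_gt0.
have GE c : synthesis G c = A c by exact: operator_synthesis AM.
pose D y := oblique_proj V W^⊥ y - A (analysis dot F y).
have VW0 := dual_disjoint dotn sV WV.
(* Until [VW] is available, [oblique_proj V W^⊥] may take its default value off [V + W^⊥], so [D] is
   controlled on sums [v + z] only. *)
have D0 v z : V v -> W^⊥ z -> D (v + z) = v - A (analysis dot F (v + z)).
  move=> Vv Wz; rewrite /D (@oblique_proj_eq _ _ _ _ _ (v + z) v)//.
  by rewrite addrC addKr.
have Deps v z : V v -> W^⊥ z -> rnorm (D (v + z)) <= eps * rnorm (v + z).
  move=> Vv Wz; apply: (le_opnorm (T := D)) Aeps; first exact: rnorm_ge0.
    by move=> r; exact: rnorm_real_scalarZ.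
  move=> r r0; rewrite -rnorm_real_scalarZ//; congr rnorm.
  rewrite scalerDr (D0 _ _ (subspaceZ _ sV Vv) (subspaceZ _ sWP Wz)).
  by rewrite -scalerDr D0// (analysisZ hF) linearZ scalerBr.
have VW : direct_sum V W^⊥.
  apply: (dual_direct_sum dotn cW cV WV (M := eps + M * Num.sqrt BF)) => v z Vv Wz.
  rewrite -[v in leLHS](subrK (A (analysis dot F (v + z)))) -D0// mulrDl.
  apply: le_trans (rnormD _ _) (lerD (Deps _ _ Vv Wz) _).
  apply: le_trans (AM _) _.
  by rewrite -mulrA ler_wpM2l ?(ltW M0)// (analysis_rnorm_le hF).
have {}Deps y : rnorm (D y) <= eps * rnorm y.
  have [v [z [Vv Wz ->]]] := proj1 VW y; exact: Deps.
have DE y : D y = oblique_proj V W^⊥ y - synthesis G (analysis dot F y).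
  by rewrite GE.
have lower f : V f ->
    (1 - eps) * rnorm f <= Num.sqrt BF * ell2_norm (analysis dot G f).
  move=> Vf; have [->|f0] := eqVneq f 0.
    by rewrite rnorm0V mulr0 mulr_ge0 ?sqrtr_ge0 ?ell2_norm_ge0.
  have fp : 0 < rnorm f by rewrite lt_def rnorm_eq0 f0 rnorm_ge0.
  (* The case [z = 0] of [D0]: the projection fixes [f], which lies in [V]. *)
  have fE : f = D f + synthesis G (analysis dot F f).
    by have := D0 f 0 Vf (proj1 sWP); rewrite addr0 => ->; rewrite GE subrK.
  rewrite -(ler_pM2l fp) mulrCA -expr2 mulrBl mul1r lerBlDl.
  rewrite -{1}(realpart_dotxx dotn) {2}fE dotDr realpartD; apply: lerD.
    apply: le_trans (realpart_le_rnorm _) _.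
    apply: le_trans (CauchySchwarz_rnorm dotn _ _) _.
    by rewrite expr2 mulrCA ler_wpM2l ?rnorm_ge0.
  rewrite (frame_operator_adjoint dotn _ _ BF0 BG0 hF hG).
  apply: le_trans (realpart_le_rnorm _) _.
  apply: le_trans (CauchySchwarz_rnorm dotn _ _) _.
  by rewrite mulrC ler_wpM2l ?rnorm_ge0// (synthesis_le dotn _ BF0 hF).
split=> //.
  split=> [n|]; first exact: VA.
  (* Obtained by squaring [lower]; it is positive because [eps < 1]. *)
  pose a := (1 - eps) ^+ 2 / BF.
  have a0 : 0 < a by rewrite divr_gt0// exprn_gt0// subr_gt0.
  (* The maximum secures the ordering of the two bounds, which the estimates alone do not give when
     [V] is zero. *)
  exists a, (Num.max a (M ^+ 2)); split=> //; first by rewrite le_max lexx.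
  move=> f Vf; rewrite (sqsum_analysis hG) !lee_fin; split.
    rewrite /a mulrAC ler_pdivrMr// -exprMn [leRHS]mulrC.
    rewrite -[BF in leRHS]sqr_sqrtr ?(ltW BF0)//.
    rewrite -exprMn ler_pXn2r ?nnegrE ?lower//.
      by rewrite mulr_ge0 ?rnorm_ge0// subr_ge0 ltW.
    by rewrite mulr_ge0 ?sqrtr_ge0 ?ell2_norm_ge0.
  apply: le_trans (analysis_le hG f) _.
  by rewrite ler_wpM2r ?sqr_ge0// le_max lexx orbT.
apply: opnorm_le => f f1; apply: (@le_trans _ _ (eps * rnorm f)); last first.
  by rewrite -[leRHS]mulr1 ler_wpM2l.
apply: (adjoint_le dotn (D := D) (E := fun f =>
  oblique_proj W V^⊥ f - synthesis F (analysis dot G f))) => // {f1}{}f y.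
by rewrite DE (oblique_error_adjoint dotn _ _ BF0 BG0 hF hG).
Qed.

End Characterization.

Theorem lemma4p5 (R : realType) (k : scalar_kind)
    (H : completeNormedModType (scalars R k))
    (dot : {dot H for conjugation R k})
    (W V : set H) (F : nat -> H) (eps : R) :
  induces_norm dot ->
  separable H ->
  closed_subspace W -> closed_subspace V ->
  direct_sum W (orthogonal_complement dot V) ->
  is_frame dot W F ->
  0 <= eps < 1 ->
  [set G : nat -> H | approx_oblique_dual dot eps W V F G] =
  [set G : nat -> H | exists A : {linear ell2 R k -> H},
     approx_oblique_left_inverse dot eps W V F A /\
     G = (fun n => A (delta R k n))].
Proof.
move=> dotn _ cW cV WV frF /andP[eps0 eps1].
apply/seteqP; split=> [G|_ [A [hA ->]]].
  exact: approx_dual_left_inverse.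
exact: left_inverse_approx_dual.
Qed.
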